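(* Let $n\in\mathbb{N}$ and let $T$ be a set of arithmetical sentences (possibly empty). The set of formulas provable in $\mathsf{S}^{\Sigma}_n$ from assumptions $T$ is closed under the induction rule $(\mathrm{IR})$ for $\Sigma_n$-formulas: if $\varphi(x)$ is a $\Sigma_n$-formula and both $\varphi(0)$ and $\forall x\,(\varphi(x)\to\varphi(s(x)))$ are provable in $\mathsf{S}^{\Sigma}_n$ from $T$, then so is $\forall x\,\varphi(x)$.
   Context: **Formulas and sequents.** Arithmetical terms are built from individual variables $\mathit{Var}=\{x_0,x_1,\dots\}$ and the constant $0$ by the unary symbol $s$ and the binary symbols $+,\cdot$. Arithmetical formulas are given by $\varphi::=t=t\mid t\neq t\mid(\varphi\wedge\varphi)\mid(\varphi\vee\varphi)\mid\forall y\,\varphi\mid\exists y\,\varphi$. Negation $\overline{\varphi}$ is the syntactic operation swapping $=$ with $\neq$, $\wedge$ with $\vee$, $\forall$ with $\exists$ (so $\overline{\overline\varphi}=\varphi$). Put $\bot:=0\neq 0$, $\varphi\to\psi:=\overline\varphi\vee\psi$. $x\leq y$ abbreviates $\exists z\,(z+x=y)$. $\varphi[y\mapsto t]$ is the substitution of $t$ for all free occurrences of $y$ (no variable of $t$ may become bound); $\varphi(t)$ stands for $\varphi[x\mapsto t]$ when $x$ is clear. A sequent is a finite multiset of formulas, interpreted as $\bigvee\Gamma$ (with $\bigvee\emptyset:=\bot$); the comma denotes multiset union. A formula $\varphi$ is called provable if the sequent $\{\varphi\}$ is. $\mathit{FV}$ denotes the set of free variables. **Classes.** Bounded quantifiers: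 $\forall y\leq t\,\varphi:=\forall y(y\leq t\to\varphi)$, $\exists y\leq t\,\varphi:=\exists y(y\leq t\wedge\varphi)$, with $y$ not in $t$. $\Delta_0=\Sigma_0=\Pi_0$ is the set of formulas built from atomic formulas by logical connectives and bounded quantifiers only. A formula is $\Sigma_{n+1}$ (resp. $\Pi_{n+1}$) if it is obtained from $\Pi_n$ (resp. $\Sigma_n$) formulas using existential (resp. universal) quantifiers and $\wedge,\vee$. **Calculus $\mathsf{SQ}$.** Initial sequents: $\Gamma,t_0=t_1,t_0\neq t_1$ and $\Gamma,s(t)\neq0$. Rules (premisses / conclusion): $(\wedge)$: $\Gamma,\varphi$ and $\Gamma,\psi$ / $\Gamma,\varphi\wedge\psi$; $(\vee)$: $\Gamma,\varphi,\psi$ / $\Gamma,\varphi\vee\psi$; $(\forall)$: $\Gamma,\varphi[y\mapsto z]$ / $\Gamma,\forall y\,\varphi$, where $z\notin\mathit{FV}(\Gamma,\forall y\,\varphi)$ ($z$ is the active variable); $(\exists)$: $\Gamma,\varphi[y\mapsto t],\exists y\,\varphi$ / $\Gamma,\exists y\,\varphi$; $(\mathsf{ref})$: $\Gamma,t\neq t$ / $\Gamma$; $(\mathsf{rep})$: $\Gamma,t_0\neq t_1,(u_0\neq u_1)[y\mapsto t_0],(u_0\neq u_1)[y\mapsto t_1]$ / $\Gamma,t_0\neq t_1,(u_0\neq u_1)[y\mapsto t_0]$; $(\mathsf{add}_0)$: $\Gamma,t+0\neq t$ / $\Gamma$; $(\mathsf{add}_s)$: $\Gamma,t+s(u)\neq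 s(t+u)$ / $\Gamma$; $(\mathsf{mult}_0)$: $\Gamma,t\cdot0\neq0$ / $\Gamma$; $(\mathsf{mult}_s)$: $\Gamma,t\cdot s(u)\neq t\cdot u+t$ / $\Gamma$; $(\mathsf{pred})$: $\Gamma,s(t_0)\neq s(t_1),t_0\neq t_1$ / $\Gamma,s(t_0)\neq s(t_1)$; $(\mathsf{case})$: left premiss $\Gamma[y\mapsto0]$ and right premiss $\Gamma[y\mapsto s(y)]$ / $\Gamma$, where $y\in\mathit{FV}(\Gamma)$ ($y$ is the active variable); $(\mathsf{weak})$: $\Gamma$ / $\Gamma,\Delta$; $(\mathsf{cut})$: left premiss $\Gamma,\varphi$ and right premiss $\Gamma,\overline\varphi$ / $\Gamma$. **Proofs of $\mathsf{S}^{\Sigma}_n$ from assumptions.** An $\infty$-proof from assumptions $T$ is a possibly infinite tree whose nodes are marked by sequents, constructed according to the rules of $\mathsf{SQ}$, with every leaf marked by an initial sequent of $\mathsf{SQ}$ or by a sequent $\{\varphi\}$ with $\varphi\in T$, such that every infinite branch has a tail satisfying conditions (a)–(c) below. It is $\Sigma_n$-restricted if every infinite branch has a tail satisfying all of the following: (a) the tail does not pass through left premisses of $(\mathsf{case})$; (b) if the tail passes through the right premiss $\Gamma[z\mapsto s(z)]$ of $(\mathsf{case})$, then after that application the tail does not intersect applications of $(\forall)$ with active variable $z$; (c) for some variable $y$, the tail passes through the right premiss of $(\mathsf{case})$ with active variable $y$ infinitely many times; (d') if the tail passes through the left (right) premiss of $(\wedge)$, then $\varphi$ ($\psi$) is in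 $\Sigma_n$; (e') the tail does not intersect applications of $(\forall)$; (f') if the tail passes through the left (right) premiss of $(\mathsf{cut})$, then $\varphi$ ($\overline\varphi$) is in $\Sigma_n$; (g') if the tail passes through the right premiss $\Gamma[z\mapsto s(z)]$ of $(\mathsf{case})$, then $\Gamma$ consists entirely of $\Sigma_n$-formulas. Such a tree is regular if it contains only finitely many non-isomorphic subtrees with respect to the marking of sequents. A sequent $\Gamma$ is provable in $\mathsf{S}^{\Sigma}_n$ from assumptions $T$ if there is a $\Sigma_n$-restricted regular $\infty$-proof from $T$ with root marked by $\Gamma$. *)

(* Defs.v *)
From HB Require Import structures.
From mathcomp Require Import all_boot.
From mathcomp Require Import finmap multiset.

Set Implicit Arguments.
Unset Strict Implicit.
Unset Printing Implicit Defensive.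

Local Open Scope mset_scope.

Inductive term : Type :=
| Var of nat
| Zero
| Succ of term
| Add of term & term
| Mul of term & term.

Inductive formula : Type :=
| Eq of term & term
| Neq of term & term
| And of formula & formula
| Or of formula & formula
| All of nat & formula
| Ex of nat & formula.

(* Countable (hence choice) structures, required by {mset formula}. *)

Fixpoint term_code (t : term) : GenTree.tree nat :=
  match t with
  | Var x => GenTree.Leaf x
  | Zero => GenTree.Node 0 [::]
  | Succ u => GenTree.Node 1 [:: term_code u]
  | Add u v => GenTree.Node 2 [:: term_code u; term_code v]
  | Mul u v => GenTree.Node 3 [:: term_code u; term_code v]
  end.

Fixpoint term_decode (c : GenTree.tree nat) : term :=
  match c with
  | GenTree.Leaf x => Var x
  | GenTree.Node 1 [:: u] => Succ (term_decode u)
  | GenTree.Node 2 [:: u; v] => Add (term_decode u) (term_decode v)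
  | GenTree.Node 3 [:: u; v] => Mul (term_decode u) (term_decode v)
  | _ => Zero
  end.

Lemma term_codeK : cancel term_code term_decode.
Proof. by elim=> //= [t -> | t -> u -> | t -> u ->]. Qed.

HB.instance Definition _ := Countable.copy term (can_type term_codeK).

Fixpoint formula_code (f : formula) : GenTree.tree (nat + term) :=
  match f with
  | Eq t u => GenTree.Node 0 [:: GenTree.Leaf (inr t); GenTree.Leaf (inr u)]
  | Neq t u => GenTree.Node 1 [:: GenTree.Leaf (inr t); GenTree.Leaf (inr u)]
  | And g h => GenTree.Node 2 [:: formula_code g; formula_code h]
  | Or g h => GenTree.Node 3 [:: formula_code g; formula_code h]
  | All y g => GenTree.Node 4 [:: GenTree.Leaf (inl y); formula_code g]
  | Ex y g => GenTree.Node 5 [:: GenTree.Leaf (inl y); formula_code g]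
  end.

Fixpoint formula_decode (c : GenTree.tree (nat + term)) : formula :=
  match c with
  | GenTree.Node 0 [:: GenTree.Leaf (inr t); GenTree.Leaf (inr u)] => Eq t u
  | GenTree.Node 1 [:: GenTree.Leaf (inr t); GenTree.Leaf (inr u)] => Neq t u
  | GenTree.Node 2 [:: g; h] => And (formula_decode g) (formula_decode h)
  | GenTree.Node 3 [:: g; h] => Or (formula_decode g) (formula_decode h)
  | GenTree.Node 4 [:: GenTree.Leaf (inl y); g] => All y (formula_decode g)
  | GenTree.Node 5 [:: GenTree.Leaf (inl y); g] => Ex y (formula_decode g)
  | _ => Eq Zero Zero
  end.

Lemma formula_codeK : cancel formula_code formula_decode.
Proof. by elim=> //= [g -> h -> | g -> h -> | y g -> | y g ->]. Qed.

HB.instance Definition _ := Countable.copy formula (can_type formula_codeK).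

Fixpoint neg (f : formula) : formula :=
  match f with
  | Eq t u => Neq t u
  | Neq t u => Eq t u
  | And g h => Or (neg g) (neg h)
  | Or g h => And (neg g) (neg h)
  | All y g => Ex y (neg g)
  | Ex y g => All y (neg g)
  end.

Definition Imp (f g : formula) : formula := Or (neg f) g.

Fixpoint tvars (t : term) : seq nat :=
  match t with
  | Var x => [:: x]
  | Zero => [::]
  | Succ u => tvars u
  | Add u v | Mul u v => tvars u ++ tvars v
  end.

Fixpoint fv (f : formula) : seq nat :=
  match f with
  | Eq t u | Neq t u => tvars t ++ tvars u
  | And g h | Or g h => fv g ++ fv h
  | All y g | Ex y g => [seq x <- fv g | x != y]
  end.

Definition sentence (f : formula) : Prop := fv f = [::].

Fixpoint tsubst (y : nat) (t : term) (u : term) : term :=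
  match u with
  | Var x => if x == y then t else Var x
  | Zero => Zero
  | Succ v => Succ (tsubst y t v)
  | Add v w => Add (tsubst y t v) (tsubst y t w)
  | Mul v w => Mul (tsubst y t v) (tsubst y t w)
  end.

(* f[y |-> t]. Bound variables are never renamed: the proviso that no variable
   of t becomes bound is the separate predicate [free_for], imposed wherever a
   substitution could violate it (it always holds for t = 0 and t = s(y)). *)
Fixpoint subst (y : nat) (t : term) (f : formula) : formula :=
  match f with
  | Eq u v => Eq (tsubst y t u) (tsubst y t v)
  | Neq u v => Neq (tsubst y t u) (tsubst y t v)
  | And g h => And (subst y t g) (subst y t h)
  | Or g h => Or (subst y t g) (subst y t h)
  | All z g => if z == y then All z g else All z (subst y t g)
  | Ex z g => if z == y then Ex z g else Ex z (subst y t g)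
  end.

Fixpoint free_for (y : nat) (t : term) (f : formula) : bool :=
  match f with
  | Eq _ _ | Neq _ _ => true
  | And g h | Or g h => free_for y t g && free_for y t h
  | All z g | Ex z g =>
      (y \notin fv (Ex z g)) || ((z \notin tvars t) && free_for y t g)
  end.

(* t <= u, with z the variable bound in the abbreviation; it must be chosen
   outside t and u. *)
Definition le_via (z : nat) (t u : term) : formula :=
  Ex z (Eq (Add (Var z) t) u).

Inductive Delta0 : formula -> Prop :=
| Delta0_eq t u : Delta0 (Eq t u)
| Delta0_neq t u : Delta0 (Neq t u)
| Delta0_and f g : Delta0 f -> Delta0 g -> Delta0 (And f g)
| Delta0_or f g : Delta0 f -> Delta0 g -> Delta0 (Or f g)
| Delta0_all y z t f :
    y \notin tvars t -> z != y -> z \notin tvars t -> Delta0 f ->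
    Delta0 (All y (Imp (le_via z (Var y) t) f))
| Delta0_ex y z t f :
    y \notin tvars t -> z != y -> z \notin tvars t -> Delta0 f ->
    Delta0 (Ex y (And (le_via z (Var y) t) f)).

Inductive closure (Q : nat -> formula -> formula) (P : formula -> Prop) :
  formula -> Prop :=
| closure_base f : P f -> closure Q P f
| closure_and f g : closure Q P f -> closure Q P g -> closure Q P (And f g)
| closure_or f g : closure Q P f -> closure Q P g -> closure Q P (Or f g)
| closure_quant y f : closure Q P f -> closure Q P (Q y f).

Fixpoint Sigma (n : nat) : formula -> Prop :=
  if n is m.+1 then closure Ex (Pi m) else Delta0
with Pi (n : nat) : formula -> Prop :=
  if n is m.+1 then closure All (Sigma m) else Delta0.

Definition sequent : Type := {mset formula}.

Definition in_fvs (y : nat) (G : sequent) : Prop :=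
  exists2 f, f \in G & y \in fv f.

Definition ssubst (y : nat) (t : term) (G : sequent) : sequent :=
  seq_mset [seq subst y t f | f <- enum_mset G].

(* What a node of a derivation stands for: a leaf (one of the first three
   constructors) or an application of a rule, together with its parameters. *)
Inductive inference : Type :=
| InitEq of sequent & term & term
| InitSucc of sequent & term
| Assumption of formula
| RAnd of sequent & formula & formula
| ROr of sequent & formula & formula
| RAll (G : sequent) (y : nat) (f : formula) (z : nat)
| REx (G : sequent) (y : nat) (f : formula) (t : term)
| RRef of sequent & term
| RRep (G : sequent) (t0 t1 : term) (y : nat) (u0 u1 : term)
| RAdd0 of sequent & term
| RAddS of sequent & term & term
| RMult0 of sequent & term
| RMultS of sequent & term & term
| RPred of sequent & term & term
| RCase of sequent & nat
| RWeak of sequent & sequent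
| RCut of sequent & formula.

Definition conclusion (r : inference) : sequent :=
  match r with
  | InitEq G t0 t1 => Eq t0 t1 +` (Neq t0 t1 +` G)
  | InitSucc G t => Neq (Succ t) Zero +` G
  | Assumption f => [mset f]
  | RAnd G f g => And f g +` G
  | ROr G f g => Or f g +` G
  | RAll G y f z => All y f +` G
  | REx G y f t => Ex y f +` G
  | RRef G t => G
  | RRep G t0 t1 y u0 u1 => Neq t0 t1 +` (subst y t0 (Neq u0 u1) +` G)
  | RAdd0 G t => G
  | RAddS G t u => G
  | RMult0 G t => G
  | RMultS G t u => G
  | RPred G t0 t1 => Neq (Succ t0) (Succ t1) +` G
  | RCase G y => G
  | RWeak G D => G `+` D
  | RCut G f => G
  end.

Definition premisses (r : inference) : seq sequent :=
  match r with
  | InitEq _ _ _ | InitSucc _ _ | Assumption _ => [::]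
  | RAnd G f g => [:: f +` G; g +` G]
  | ROr G f g => [:: f +` (g +` G)]
  | RAll G y f z => [:: subst y (Var z) f +` G]
  | REx G y f t => [:: subst y t f +` (Ex y f +` G)]
  | RRef G t => [:: Neq t t +` G]
  | RRep G t0 t1 y u0 u1 =>
      [:: Neq t0 t1 +`
            (subst y t0 (Neq u0 u1) +` (subst y t1 (Neq u0 u1) +` G))]
  | RAdd0 G t => [:: Neq (Add t Zero) t +` G]
  | RAddS G t u => [:: Neq (Add t (Succ u)) (Succ (Add t u)) +` G]
  | RMult0 G t => [:: Neq (Mul t Zero) Zero +` G]
  | RMultS G t u => [:: Neq (Mul t (Succ u)) (Add (Mul t u) t) +` G]
  | RPred G t0 t1 => [:: Neq (Succ t0) (Succ t1) +` (Neq t0 t1 +` G)]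
  | RCase G y => [:: ssubst y Zero G; ssubst y (Succ (Var y)) G]
  | RWeak G D => [:: G]
  | RCut G f => [:: f +` G; neg f +` G]
  end.

Definition admissible (T : formula -> Prop) (r : inference) : Prop :=
  match r with
  | Assumption f => T f
  | RAll G y f z => free_for y (Var z) f /\ ~ in_fvs z (All y f +` G)
  | REx G y f t => free_for y t f
  | RCase G y => in_fvs y G
  | _ => True
  end.

(* A possibly infinite ordered tree is a partial function on addresses: the
   empty address is the root, and [rcons a i] is the i-th child of [a] (0 is
   the left premiss, 1 the right one). *)
Definition tree (A : Type) : Type := seq nat -> option A.

Definition subtree (A : Type) (m : tree A) (a : seq nat) : tree A :=
  fun c => m (a ++ c).

Definition marking (p : tree inference) : tree sequent :=
  fun a => omap conclusion (p a).

Definition derivation (T : formula -> Prop) (p : tree inference) : Prop :=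
  [/\ p [::] <> None,
      forall a i, p a = None -> p (rcons a i) = None
    & forall a r, p a = Some r ->
        admissible T r /\
        forall i, marking p (rcons a i) = onth (premisses r) i].

(* An infinite branch is given by the child b k it takes at each depth k; its
   node at depth k then has address [mkseq b k], and it passes through the
   premiss of index b k of the rule applied there. *)
Definition branch_node (p : tree inference) (b : nat -> nat) (k : nat) :
  option inference := p (mkseq b k).

Definition infinite_branch (p : tree inference) (b : nat -> nat) : Prop :=
  forall k, branch_node p b k <> None.

(* The conditions below concern the tail, from depth N on, of the branch b. *)
Definition cond_a (p : tree inference) (b : nat -> nat) (N : nat) : Prop :=
  forall k G y, N <= k -> branch_node p b k = Some (RCase G y) -> b k <> 0.

Definition cond_b (p : tree inference) (b : nat -> nat) (N : nat) : Prop :=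
  forall k G z, N <= k -> branch_node p b k = Some (RCase G z) -> b k = 1 ->
  forall j D y f, k < j -> branch_node p b j <> Some (RAll D y f z).

Definition cond_c (p : tree inference) (b : nat -> nat) (N : nat) : Prop :=
  exists y, forall M, exists k G,
    [/\ N <= k, M <= k, branch_node p b k = Some (RCase G y) & b k = 1].

Definition cond_d' (p : tree inference) (b : nat -> nat) (N n : nat) : Prop :=
  forall k G f g, N <= k -> branch_node p b k = Some (RAnd G f g) ->
  (b k = 0 -> Sigma n f) /\ (b k = 1 -> Sigma n g).

Definition cond_e' (p : tree inference) (b : nat -> nat) (N : nat) : Prop :=
  forall k G y f z, N <= k -> branch_node p b k <> Some (RAll G y f z).

Definition cond_f' (p : tree inference) (b : nat -> nat) (N n : nat) : Prop :=
  forall k G f, N <= k -> branch_node p b k = Some (RCut G f) ->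
  (b k = 0 -> Sigma n f) /\ (b k = 1 -> Sigma n (neg f)).

Definition cond_g' (p : tree inference) (b : nat -> nat) (N n : nat) : Prop :=
  forall k G z, N <= k -> branch_node p b k = Some (RCase G z) -> b k = 1 ->
  forall f, f \in G -> Sigma n f.

Definition infty_proof (T : formula -> Prop) (p : tree inference) : Prop :=
  derivation T p /\
  forall b, infinite_branch p b ->
    exists N, [/\ cond_a p b N, cond_b p b N & cond_c p b N].

Definition Sigma_restricted (n : nat) (p : tree inference) : Prop :=
  forall b, infinite_branch p b ->
    exists N, [/\ cond_a p b N, cond_b p b N & cond_c p b N] /\
      [/\ cond_d' p b N n, cond_e' p b N, cond_f' p b N n & cond_g' p b N n].

(* Isomorphic ordered marked trees are represented by pointwise equal partial
   functions, and only the sequents, not the rules, are compared. *)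
Definition regular (p : tree inference) : Prop :=
  exists L : seq (seq nat), forall a, p a <> None ->
    exists2 a', a' \in L &
      subtree (marking p) a =1 subtree (marking p) a'.

Definition provable (n : nat) (T : formula -> Prop) (G : sequent) : Prop :=
  exists p, [/\ infty_proof T p, Sigma_restricted n p, regular p
              & marking p [::] = Some G].

Definition fprovable (n : nat) (T : formula -> Prop) (f : formula) : Prop :=
  provable n T [mset f].

(* Main.v *)
(** The formula [forall x phi] is proved cyclically: (case) on [x] splits [phi]
    into [phi(0)], which is given, and [phi(s x)]; the latter is cut against
    [phi], so that the left premiss weakens back to [phi] and closes the cycle,
    while the right premiss [~ phi, phi(s x)] is the induction step.  The only new
    infinite branch runs round this cycle forever; it meets no other rules than
    (case), (cut) on [phi] and (weak), so all the conditions on tails reduce to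
    [phi] being in Sigma_n.  When [x] is not free in [phi], (case) is not
    applicable, but then [phi] is [phi(0)]. *)

From mathcomp Require Import all_boot.
From mathcomp Require Import finmap multiset zify.
From Stdlib Require Import Classical_Prop.
Require Import Defs.

Set Implicit Arguments.
Unset Strict Implicit.
Unset Printing Implicit Defensive.

Local Open Scope mset_scope.

(** * Syntax: negation, substitution and fresh variables *)

Lemma negK : involutive neg.
Proof. by elim=> //= [f -> g ->|f -> g ->|y f ->|y f ->]. Qed.

Lemma fv_neg f : fv (neg f) = fv f.
Proof. by elim: f => //= [f -> g ->|f -> g ->|y f ->|y f ->]. Qed.

Lemma neg_subst y t f : neg (subst y t f) = subst y t (neg f).
Proof.
elim: f => //= [f -> g ->|f -> g ->|z f IH|z f IH] //;
  by case: (z == y) => //=; rewrite IH.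
Qed.

Lemma free_for_neg y t f : free_for y t (neg f) = free_for y t f.
Proof.
by elim: f => //= [f -> g ->|f -> g ->|z f ->|z f ->] //; rewrite fv_neg.
Qed.

Lemma tsubst_id y u : tsubst y (Var y) u = u.
Proof.
elim: u => //= [z|u ->|u -> v ->|u -> v ->] //.
by case: eqP => // ->.
Qed.

Lemma subst_id y f : subst y (Var y) f = f.
Proof.
elim: f => //= [u v|u v|f -> g ->|f -> g ->|z f ->|z f ->] //;
  by rewrite ?tsubst_id ?if_same.
Qed.

Lemma tsubst_notin y t u : y \notin tvars u -> tsubst y t u = u.
Proof.
elim: u => //= [z|u IH /IH ->|u IHu v IHv|u IHu v IHv] //.
- by rewrite inE eq_sym => /negPf ->.
- by rewrite mem_cat => /norP[/IHu -> /IHv ->].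
- by rewrite mem_cat => /norP[/IHu -> /IHv ->].
Qed.

Lemma subst_notin y t f : y \notin fv f -> subst y t f = f.
Proof.
elim: f => //= [u v|u v|f IHf g IHg|f IHf g IHg|z f IH|z f IH].
- by rewrite mem_cat => /norP[yu yv]; rewrite !tsubst_notin.
- by rewrite mem_cat => /norP[yu yv]; rewrite !tsubst_notin.
- by rewrite mem_cat => /norP[/IHf -> /IHg ->].
- by rewrite mem_cat => /norP[/IHf -> /IHg ->].
- by rewrite mem_filter eq_sym; case: eqP => //= _ /IH ->.
- by rewrite mem_filter eq_sym; case: eqP => //= _ /IH ->.
Qed.

Lemma free_for_id y f : free_for y (Var y) f.
Proof.
elim: f => //= [f -> g ->|f -> g ->|z f ->|z f ->] //;
  by rewrite mem_filter inE (eq_sym z) andbT; case: (y == z); rewrite ?orbT.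
Qed.

(** Avoiding these variables is a crude but sufficient test for [free_for]. *)
Fixpoint bvars (f : formula) : seq nat :=
  match f with
  | Eq _ _ | Neq _ _ => [::]
  | And g h | Or g h => bvars g ++ bvars h
  | All y g | Ex y g => y :: bvars g
  end.

Lemma free_for_fresh y z f : z \notin bvars f -> free_for y (Var z) f.
Proof.
elim: f => //= [f IHf g IHg|f IHf g IHg|w f IH|w f IH].
- by rewrite mem_cat => /norP[/IHf -> /IHg ->].
- by rewrite mem_cat => /norP[/IHf -> /IHg ->].
- by rewrite !inE => /norP[zw /IH ->]; rewrite eq_sym zw orbT.
- by rewrite !inE => /norP[zw /IH ->]; rewrite eq_sym zw orbT.
Qed.

Lemma fresh_nat (s : seq nat) : exists z, z \notin s.
Proof.
exists (\max_(i <- s) i).+1; apply/negP => zs.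
by have := @leq_bigmax_seq _ s xpredT id _ zs isT; rewrite ltnn.
Qed.

Lemma fresh_var f (G : sequent) : exists z, z \notin bvars f /\ ~ in_fvs z G.
Proof.
have [z] := fresh_nat (bvars f ++ flatten [seq fv g | g <- enum_mset G]).
rewrite mem_cat => /norP[zf /negP zG]; exists z; split=> // -[g gG zg].
by apply: zG; apply/flattenP; exists (fv g) => //; apply: map_f.
Qed.

(** Terms do not count, so that instances of a formula have its size. *)
Fixpoint fsize (f : formula) : nat :=
  match f with
  | Eq _ _ | Neq _ _ => 0
  | And g h | Or g h => (fsize g + fsize h).+1
  | All _ g | Ex _ g => (fsize g).+1
  end.

Lemma fsize_subst y t f : fsize (subst y t f) = fsize f.
Proof.
elim: f => //= [f -> g ->|f -> g ->|z f IH|z f IH] //;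
  by case: (z == y) => //=; rewrite IH.
Qed.

(** * Tails of branches and closure of provability under the rules *)

Definition good_tail (n : nat) (p : tree inference) (b : nat -> nat) (N : nat) :
    Prop :=
  [/\ cond_a p b N, cond_b p b N & cond_c p b N] /\
  [/\ cond_d' p b N n, cond_e' p b N, cond_f' p b N n & cond_g' p b N n].

(** The tail clause of [infty_proof] is subsumed by [Sigma_restricted], so each tail condition is
    carried only once. *)
Definition sigma_proof (n : nat) (T : formula -> Prop) (p : tree inference)
    (G : sequent) : Prop :=
  [/\ derivation T p, Sigma_restricted n p, regular p
    & marking p [::] = Some G].

Lemma provableP n T G : provable n T G <-> exists p, sigma_proof n T p G.
Proof.
split=> [[p [[Dp _] Sp Rp Mp]]|[p [Dp Sp Rp Mp]]]; exists p; split=> //.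
split=> // b /Sp[N [abc _]]; by exists N.
Qed.

Lemma mkseq_add (b : nat -> nat) k j :
  mkseq b (k + j) = mkseq b k ++ mkseq (fun i => b (k + i)) j.
Proof.
rewrite /mkseq iotaD map_cat add0n -[in iota k j](addn0 k) iotaDl -map_comp.
by congr (_ ++ _); apply: eq_map => i /=.
Qed.

(** Every condition looks only at nodes and choices beyond the threshold, so a prefix of length [k]
    merely moves the threshold. *)
Lemma good_tail_shift n p q b k N :
  (forall c, p (mkseq b k ++ c) = q c) ->
  good_tail n q (fun i => b (k + i)) N -> good_tail n p b (k + N).
Proof.
move=> pq [[ca cb cc] [cd ce cf cg]].
have node j : k + N <= j ->
    [/\ N <= j - k, branch_node p b j = branch_node q (fun i => b (k + i)) (j - k)
      & b j = b (k + (j - k))].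
  move=> kNj; have kj : k + (j - k) = j by lia.
  by split; [lia | rewrite /branch_node -pq -mkseq_add kj | rewrite kj].
split; split.
- by move=> j G y /node[Nj -> ->]; apply: ca Nj.
- move=> j G z Nj; have [Nj' -> ->] := node _ Nj => hj bj i D y f ji.
  have [Ni -> _] : _ := node i (leq_trans Nj (ltnW ji)).
  by apply: cb hj bj _ _ _ _ _ => //; lia.
- have [y cy] := cc; exists y => M; have [j [G [Nj Mj hj bj]]] := cy M.
  exists (k + j), G; split=> //; try lia.
  by rewrite /branch_node mkseq_add pq.
- by move=> j G f g /node[Nj -> ->]; apply: cd Nj.
- by move=> j G y f z /node[Nj -> _]; apply: ce Nj.
- by move=> j G f /node[Nj -> ->]; apply: cf Nj.
- by move=> j G z /node[Nj -> ->]; apply: cg Nj.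
Qed.

(** Used whenever a branch enters a grafted copy of a restricted proof. *)
Lemma good_tail_subtree n p q b k :
  Sigma_restricted n q -> infinite_branch p b ->
  (forall c, p (mkseq b k ++ c) = q c) -> exists N, good_tail n p b N.
Proof.
move=> Sq Ip pq.
have Iq : infinite_branch q (fun i => b (k + i)).
  by move=> j; rewrite /branch_node -pq -mkseq_add; apply: Ip.
by have [N gN] := Sq _ Iq; exists (k + N); apply: good_tail_shift pq gN.
Qed.

(** The family [ps] is indexed by all of [nat]; the test on [premisses r] cuts off the surplus
    children. *)
Definition node (r : inference) (ps : nat -> tree inference) : tree inference :=
  fun a => if a is i :: c then
             (if onth (premisses r) i is Some _ then ps i c else None)
           else Some r.

Lemma derivation_node T r ps :
  admissible T r ->
  (forall i D, onth (premisses r) i = Some D ->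
     derivation T (ps i) /\ marking (ps i) [::] = Some D) ->
  derivation T (node r ps).
Proof.
move=> Ar Hps; split=> // [[|i c] j //=|[|i c] s /=].
  case E: (onth _ _) => [D|//].
  by have [[_ cl _] _] := Hps _ _ E; apply: cl.
- move=> [<-]; split=> // i; rewrite /marking /=.
  case E: (onth _ _) => [D|//].
  by have [_ <-] := Hps _ _ E.
- case E: (onth _ _) => [D|//] hs.
  have [[_ _ /(_ _ _ hs)[As Ms]] _] := Hps _ _ E.
  by split=> // j; rewrite -Ms /marking /= E.
Qed.

Lemma finite_choice (A : Type) (P : nat -> A -> Prop) (a0 : A) m :
  (forall i, i < m -> exists x, P i x) ->
  exists F : nat -> A, forall i, i < m -> P i (F i).
Proof.
elim: m => [_|m IH H]; first by exists (fun _ => a0).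
have [F HF] := IH (fun i im => H i (ltnW im)).
have [x Px] := H m (ltnSn m).
exists (fun i => if i == m then x else F i) => i; rewrite ltnS leq_eqVlt.
by case: eqP => [->|_ /= /HF].
Qed.

(** A subtree is either the whole tree or lies in one of the finitely many premiss proofs, each with
    finitely many representatives. *)
Lemma regular_node r ps :
  (forall i D, onth (premisses r) i = Some D -> regular (ps i)) ->
  regular (node r ps).
Proof.
move=> Hps; pose m := size (premisses r).
pose covers i (L : seq (seq nat)) := forall a, ps i a <> None ->
  exists2 a', a' \in L & subtree (marking (ps i)) a =1 subtree (marking (ps i)) a'.
have [Ls HL] : exists Ls, forall i, i < m -> covers i (Ls i).
  apply: (finite_choice [::]) => i.
  rewrite -onthTE; case E: (onth _ _) => [D|//] _.
  exact: Hps E.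
exists ([::] :: [seq i :: a | i <- iota 0 m, a <- Ls i]) => -[|i c] /=.
  by move=> _; exists [::] => //; rewrite inE.
case E: (onth _ _) => [D|//] pc.
have im : i < m by rewrite -onthTE E.
have [a' La' eqa] := HL i im c pc; exists (i :: a').
  rewrite inE; apply/orP; right; apply/allpairsPdep; exists i, a'.
  by split=> //; rewrite mem_iota.
by move=> d; have := eqa d; rewrite /subtree /marking /= E.
Qed.

Lemma Sigma_restricted_node n r ps :
  (forall i D, onth (premisses r) i = Some D -> Sigma_restricted n (ps i)) ->
  Sigma_restricted n (node r ps).
Proof.
(* The node at depth 1 exists, so the first choice of [b] points to an actual premiss. *)
move=> Hps b Ib; have := Ib 1; rewrite /branch_node /=.
case E: (onth _ _) => [D|//] _.
apply: (good_tail_subtree (k := 1) (Hps _ _ E) Ib) => c.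
by rewrite /= E.
Qed.

Lemma provable_rule n T r :
  admissible T r ->
  (forall i D, onth (premisses r) i = Some D -> provable n T D) ->
  provable n T (conclusion r).
Proof.
move=> Ar Hr.
pose proves i p := forall D, onth (premisses r) i = Some D -> sigma_proof n T p D.
have [ps Hps] : exists ps, forall i, i < size (premisses r) -> proves i (ps i).
  apply: (finite_choice (fun _ => None)) => i.
  rewrite -onthTE; case E: (onth _ _) => [D|//] _.
  have /provableP[p pD] := Hr _ _ E.
  by exists p => D'; rewrite E => -[<-].
have {}Hps i D : onth (premisses r) i = Some D -> sigma_proof n T (ps i) D.
  by move=> E; apply: Hps (E); rewrite -onthTE E.
apply/provableP; exists (node r ps); split=> //.
- by apply: derivation_node => // i D /Hps[].
- by apply: Sigma_restricted_node => i D /Hps[].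
- by apply: regular_node => i D /Hps[].
Qed.

Lemma provable_rule1 n T r D :
  admissible T r -> premisses r = [:: D] -> provable n T D ->
  provable n T (conclusion r).
Proof. by move=> Ar Er HD; apply: provable_rule => // -[|[]] E; rewrite Er // => -[<-]. Qed.

Lemma provable_rule2 n T r D E :
  admissible T r -> premisses r = [:: D; E] ->
  provable n T D -> provable n T E -> provable n T (conclusion r).
Proof.
by move=> Ar Er HD HE; apply: provable_rule => // -[|[|[]]] F; rewrite Er // => -[<-].
Qed.

(** * Excluded middle and inversion of a universal implication *)

Lemma provable_weak n T G D : provable n T G -> provable n T (G `+` D).
Proof. exact: (provable_rule1 (r := RWeak G D)). Qed.

(** With [f'] and [g'] in place of negations, both the conjunction and the disjunction case of the
    identity lemma are instances. *)
Lemma provable_and_or n T f f' g g' (G : sequent) :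
  (forall D, provable n T (f +` (f' +` D))) ->
  (forall D, provable n T (g +` (g' +` D))) ->
  provable n T (And f g +` (Or f' g' +` G)).
Proof.
move=> Hf Hg; rewrite msetDCA.
apply: (provable_rule1 (r := ROr (And f g +` G) f' g')) => //.
rewrite (msetDCA [mset g']) msetDCA.
apply: (provable_rule2 (r := RAnd (f' +` (g' +` G)) f g)) => //.
by rewrite (msetDCA [mset f']).
Qed.

Lemma provable_all_ex n T y f (G : sequent) :
  (forall z D, provable n T (subst y (Var z) f +` (neg (subst y (Var z) f) +` D))) ->
  provable n T (All y f +` (Ex y (neg f) +` G)).
Proof.
move=> Hf; have [z [zf zG]] := fresh_var f (All y f +` (Ex y (neg f) +` G)).
apply: (provable_rule1 (r := RAll (Ex y (neg f) +` G) y f z)) => //.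
  by split=> //; apply: free_for_fresh.
rewrite msetDCA.
apply: (provable_rule1
          (r := REx (subst y (Var z) f +` G) y (neg f) (Var z))) => //.
  by rewrite /= free_for_neg free_for_fresh.
by rewrite (msetDCA [mset Ex _ _]) msetDCA -neg_subst.
Qed.

(** Induction is on size, since the quantifier cases pass to an instance of the body with a fresh
    variable. *)
Lemma provable_identity n T f (G : sequent) :
  provable n T (f +` (neg f +` G)).
Proof.
have [m] := ubnP (fsize f); elim: m f G => // m IH.
have IHneg f (D : sequent) : fsize f < m -> provable n T (neg f +` (f +` D)).
  by move=> fm; rewrite msetDCA; apply: IH.
case=> [t u|t u|f g|f g|y f|y f] G /= fm.
- by apply: (provable_rule (r := InitEq G t u)) => //= -[].
- rewrite msetDCA.
  by apply: (provable_rule (r := InitEq G t u)) => //= -[].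
- by apply: provable_and_or => D; apply: IH; lia.
- by rewrite msetDCA; apply: provable_and_or => D; apply: IHneg; lia.
- by apply: provable_all_ex => z D; apply: IH; rewrite fsize_subst; lia.
(* The existential case is the universal one for [neg f], once [f] is read as its double
   negation. *)
- rewrite msetDCA -[in Ex y f](negK f).
  apply: provable_all_ex => z D; rewrite -neg_subst negK.
  by apply: IHneg; rewrite fsize_subst; lia.
Qed.

(** Cut with the implication: its negation is existential, is witnessed by [x] itself, and both
    resulting conjuncts close by excluded middle. *)
Lemma provable_all_imp n T x f g :
  fprovable n T (All x (Imp f g)) -> provable n T (neg f +` [mset g]).
Proof.
move=> H; set A := All x (Imp f g) in H; set G := neg f +` [mset g].
apply: (provable_rule2 (r := RCut G A)) => //; first exact: provable_weak.
apply: (provable_rule1 (r := REx G x (And (neg (neg f)) (neg g)) (Var x))) => //.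
  exact: free_for_id.
rewrite subst_id; set E := Ex _ _.
apply: (provable_rule2 (r := RAnd (E +` G) (neg (neg f)) (neg g))) => //.
- rewrite negK (msetDCA [mset E]); exact: provable_identity.
- by rewrite /G (msetDC [mset neg f]) !(msetDCA _ [mset g]); apply: provable_identity.
Qed.

Lemma provable_all n T x f : fprovable n T f -> fprovable n T (All x f).
Proof.
move=> H; rewrite /fprovable -[[mset All x f]]msetD0.
(* The bound variable can itself be the active one, as the context is empty. *)
apply: (provable_rule1 (r := RAll mset0 x f x)) => //.
  split; first exact: free_for_id.
  by case=> g; rewrite in_mset1D in_mset0 orbF => /eqP->; rewrite mem_filter eqxx.
by rewrite subst_id msetD0.
Qed.

(** * The cyclic proof *)

Lemma ssubst1 y t f : ssubst y t [mset f] = [mset subst y t f].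
Proof.
rewrite /ssubst enum_msetn /= mset_cons -[RHS]msetD0; congr (_ `+` _).
by apply/msetP => g; rewrite mset_seqE mset0E.
Qed.

Section InductionCycle.

Variables (n : nat) (T : formula -> Prop) (x : nat) (phi : formula).
Variables (p0 pS : tree inference).

Let phiS := subst x (Succ (Var x)) phi.

(* The addresses [1; 0; 0] ^ k are those of the occurrences of [phi]. *)
Fixpoint cycle (a : seq nat) : option inference :=
  match a with
  | [::] => Some (RCase [mset phi] x)
  | 0 :: c => p0 c
  | [:: 1] => Some (RCut [mset phiS] phi)
  | [:: 1; 0] => Some (RWeak [mset phi] [mset phiS])
  | 1 :: 0 :: 0 :: c => cycle c
  | 1 :: 1 :: c => pS c
  | _ => None
  end.

(** Case analysis by position: the three nodes of a lap, the two grafted proofs, a further lap, and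
    addresses outside the tree. Completing a lap strips three entries, whence induction on the
    length. *)
Lemma cycle_ind (P : seq nat -> Prop) :
  P [::] -> P [:: 1] -> P [:: 1; 0] ->
  (forall c, P (0 :: c)) -> (forall c, P (1 :: 1 :: c)) ->
  (forall c, P c -> P (1 :: 0 :: 0 :: c)) ->
  (forall a, (forall c, cycle (a ++ c) = None) -> P a) ->
  forall a, P a.
Proof.
move=> P0 P1 P10 HP0 HPS IH HN a.
have [m] := ubnP (size a); elim: m a => // m IHm.
case=> [|[|[|i]] a] // sa; last exact: HN.
case: a sa => [|[|[|i]] a] // sa; last exact: HN.
case: a sa => [|[|i] a] // sa; last exact: HN.
by apply/IH/IHm; move: sa => /=; lia.
Qed.

Hypothesis xphi : x \in fv phi.
Hypothesis hphi : Sigma n phi.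
Hypothesis hp0 : sigma_proof n T p0 [mset subst x Zero phi].
Hypothesis hpS : sigma_proof n T pS (neg phi +` [mset phiS]).

Lemma derivation_cycle : derivation T cycle.
Proof.
have [[_ cl0 ok0] _ _ M0] := hp0; have [[_ clS okS] _ _ MS] := hpS.
split=> // a.
- elim/cycle_ind: a => // a aN i _.
  by rewrite -cats1 aN.
- elim/cycle_ind: a => [||||||a aN] //.
  + move=> _ [<-] /=; split; first by exists phi => //; rewrite in_mset1.
    by case=> [|[|[|i]]] //=; rewrite ssubst1.
  + by move=> _ [<-]; split=> // -[|[|[|i]]].
  + by move=> _ [<-]; split=> // -[|[|i]].
  + by move=> r; rewrite -[a in cycle a]cats0 aN.
Qed.

Lemma regular_cycle : regular cycle.
Proof.
have [_ _ [L0 H0] _] := hp0; have [_ _ [LS HS] _] := hpS.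
exists ([:: [::]; [:: 1]; [:: 1; 0]] ++ map (cons 0) L0 ++
        map (fun a => 1 :: 1 :: a) LS) => a.
elim/cycle_ind: a => [||||||a aN].
- by exists [::].
- by exists [:: 1].
- by exists [:: 1; 0].
- move=> c /H0[c' Lc' eqc]; exists (0 :: c') => //.
  by rewrite !mem_cat (map_f (cons 0) Lc') orbT.
- move=> c /HS[c' Lc' eqc]; exists (1 :: 1 :: c') => //.
  by rewrite !mem_cat (map_f (fun a => 1 :: 1 :: a) Lc') !orbT.
(* After a lap [cycle] computes to itself, so the representative for [c] serves again. *)
- by [].
- by rewrite -[a in cycle a]cats0 aN.
Qed.

(** Each lap takes the right premiss of (case), the left premiss of (cut) and the premiss of (weak),
    and is back at the root. *)
Lemma cycle_lap (b : nat -> nat) m c :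
  (forall i, i < m -> [/\ b (3 * i) = 1, b (3 * i).+1 = 0 & b (3 * i).+2 = 0]) ->
  cycle (mkseq b (3 * m) ++ c) = cycle c.
Proof.
elim: m c => // m IH c lap.
rewrite mulnS addnC mkseq_add -catA IH => [|i im]; last by apply: lap; lia.
by rewrite /mkseq /= addn0 addn1 addn2; have [-> -> ->] := lap m (ltnSn m).
Qed.

Lemma good_tail_cycle b :
  (forall i, [/\ b (3 * i) = 1, b (3 * i).+1 = 0 & b (3 * i).+2 = 0]) ->
  good_tail n cycle b 0.
Proof.
move=> lap.
(* The depth modulo 3 determines the rule and the choice made there; all conditions are then read
   off from these three cases. *)
have nodeE k : [\/ branch_node cycle b k = Some (RCase [mset phi] x) /\ b k = 1,
    branch_node cycle b k = Some (RCut [mset phiS] phi) /\ b k = 0 |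
    branch_node cycle b k = Some (RWeak [mset phi] [mset phiS])].
  have [i [j [j3 ->]]] : exists i j, j < 3 /\ k = 3 * i + j.
    by exists (k %/ 3), (k %% 3); lia.
  rewrite /branch_node mkseq_add cycle_lap //.
  have [b0 b1 b2] := lap i.
  case: j j3 => [|[|[|//]]] _; rewrite /mkseq /= ?addn0 ?addn1 ?addn2 ?b0 ?b1.
  - exact: Or31.
  - exact: Or32.
  - exact: Or33.
have noall k G y f z : branch_node cycle b k <> Some (RAll G y f z).
  by case: (nodeE k) => [[->]|[->]|->].
split; split.
- by move=> k G y _; case: (nodeE k) => [[-> ->]|[->]|->].
- by move=> k G z _ _ _ j D y f _; apply: noall.
(* Lap number [M] starts at depth [3 * M], which is at least [M]. *)
- exists x => M; exists (3 * M), [mset phi]; split=> //; first by lia.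
    by rewrite /branch_node -[mkseq _ _]cats0 cycle_lap.
  by have [] := lap M.
- by move=> k G f g _; case: (nodeE k) => [[->]|[->]|->].
- by move=> k G y f z _; apply: noall.
- by move=> k G f _; case: (nodeE k) => [[->]|[-> ->] [_ <-]|->].
- move=> k G z _; case: (nodeE k) => [[-> _]|[->]|->] // -[<- _] _ f.
  by rewrite in_mset1 => /eqP->.
Qed.

(** A branch either laps forever or has a first incomplete lap, during which it escapes into [p0] or
    [pS] and inherits a good tail. Excluded middle decides between the two. *)
Lemma Sigma_restricted_cycle : Sigma_restricted n cycle.
Proof.
have [_ S0 _ _] := hp0; have [_ SS _ _] := hpS => b Ib.
pose lap i := [&& b (3 * i) == 1, b (3 * i).+1 == 0 & b (3 * i).+2 == 0].
have lapP i : lap i -> [/\ b (3 * i) = 1, b (3 * i).+1 = 0 & b (3 * i).+2 = 0].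
  by case/and3P=> /eqP ? /eqP ? /eqP.
have [[i Ni]|all_lap] := classic (exists i, ~~ lap i); last first.
  exists 0; apply: good_tail_cycle => i; apply: lapP.
  by apply/negPn/negP => Ni; apply: all_lap; exists i.
have [m Nm min_m] := ex_minnP (ex_intro (fun i => ~~ lap i) i Ni).
have lap_lt j : j < m -> [/\ b (3 * j) = 1, b (3 * j).+1 = 0 & b (3 * j).+2 = 0].
  by move=> jm; apply/lapP/negPn/negP => /min_m; rewrite leqNgt jm.
have at_m j c : cycle (mkseq b (3 * m + j) ++ c) =
    cycle (mkseq (fun i => b (3 * m + i)) j ++ c).
  by rewrite mkseq_add -catA cycle_lap.
have Im j : cycle (mkseq (fun i => b (3 * m + i)) j) <> None.
  by have := Ib (3 * m + j); rewrite /branch_node -[mkseq b _]cats0 at_m cats0.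
have := Im 1; have := Im 2; have := Im 3; rewrite /mkseq /= addn0 addn1 addn2.
(* Left at (case): the branch enters [p0]. *)
case b0: (b (3 * m)) => [|[|//]].
  move=> _ _ _; apply: (good_tail_subtree (k := 3 * m + 1) S0 Ib) => c.
  by rewrite at_m /mkseq /= addn0 b0.
(* Left at (cut) would force the only premiss of (weak) and complete lap [m]; right at (cut) enters
   [pS]. *)
case b1: (b (3 * m).+1) => [|[|//]].
  by case b2: (b (3 * m).+2) => [|//]; rewrite /lap b0 b1 b2 in Nm.
move=> _ _ _; apply: (good_tail_subtree (k := 3 * m + 2) SS Ib) => c.
by rewrite at_m /mkseq /= addn0 addn1 b0 b1.
Qed.

Lemma sigma_proof_cycle : sigma_proof n T cycle [mset phi].
Proof.
split=> //; [exact: derivation_cycle | exact: Sigma_restricted_cycle |].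
exact: regular_cycle.
Qed.

End InductionCycle.

Theorem lemma6p2 (n : nat) (T : formula -> Prop)
  (hT : forall psi, T psi -> sentence psi)
  (x : nat) (phi : formula) (hphi : Sigma n phi)
  (h0 : fprovable n T (subst x Zero phi))
  (hS : fprovable n T (All x (Imp phi (subst x (Succ (Var x)) phi)))) :
  fprovable n T (All x phi).
Proof.
apply: provable_all.
have [xphi|xphi] := boolP (x \in fv phi); last by rewrite subst_notin in h0.
have /provableP[p0 hp0] := h0.
have /provableP[pS hpS] := provable_all_imp hS.
by apply/provableP; exists (cycle x phi p0 pS); apply: sigma_proof_cycle hp0 hpS.
Qed.
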